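(* (a) Let $(b_n)_{n\ge1}$ be a sequence in $(1,\infty)$. Then \[ \lambda(\{\mathsf a'_n>b_n\text{ for infinitely many }n\})=\begin{cases}1&\text{if }\sum_{n\ge1}\frac{1}{b_n\log b_n}=\infty,\\ 0&\text{otherwise.}\end{cases} \] (b) If moreover $(b_n)$ is non-decreasing, then \[ \lambda(\{\mathsf a'_n>b_n\text{ i.o.}\})=\lambda(\{\mathsf M'_n>b_n\text{ i.o.}\}). \]
   Context: $I=(0,1]$, $\lambda$ is Lebesgue measure on $I$, and $\mathsf a_n(x)$ denotes the $n$-th continued fraction digit of $x\in I$, i.e. $x=[\mathsf a_1(x),\mathsf a_2(x),\dots]=1/(\mathsf a_1(x)+1/(\mathsf a_2(x)+\cdots))$. $\mathbb P$ is the set of primes. The prime digits are $\mathsf a'_n(x):=\mathsf a_n(x)$ if $\mathsf a_n(x)\in\mathbb P$ and $\mathsf a'_n(x):=0$ otherwise. $\mathsf M'_n:=\max_{1\le k\le n}\mathsf a'_k$. ''i.o.'' means ''for infinitely many $n$''. *)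

(* Defs.v *)
From mathcomp Require Import all_boot all_order all_algebra all_classical all_reals all_analysis.
Set Implicit Arguments. Unset Strict Implicit. Unset Printing Implicit Defensive.
Import Order.TTheory GRing.Theory Num.Theory.
Local Open Scope ring_scope.

(* Gauss map T x = 1/x - floor(1/x) (with MathComp's convention 0^-1 = 0). *)
Definition gauss {R : realType} (x : R) : R := x^-1 - (Num.truncn (x^-1))%:R.

(* n-th continued fraction digit, n >= 1: a_n(x) = floor(1 / T^(n-1) x).
   For x in (0,1] irrational this is the usual digit; once the expansion
   terminates (T^(n-1) x = 0) the digit is 0 (a Lebesgue-null set of x). *)
Definition cf_digit {R : realType} (n : nat) (x : R) : nat :=
  Num.truncn ((iter n.-1 gauss x)^-1).

Definition prime_digit {R : realType} (n : nat) (x : R) : nat :=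
  if prime (cf_digit n x) then cf_digit n x else 0%N.

Definition prime_digit_max {R : realType} (n : nat) (x : R) : nat :=
  \max_(1 <= k < n.+1) prime_digit k x.

Definition unitI {R : realType} : set R := [set x | 0 < x <= 1].

Definition io_set {R : realType} (P : nat -> R -> Prop) : set R :=
  [set x | unitI x /\ forall N : nat, exists n : nat, (N <= n)%N /\ (0 < n)%N /\ P n x].

(* Main.v *)
(* For s in [0, 1] let nu_s be the law on (0, 1) with density
   (1 + s) / (1 + s x)^2, so that nu_0 is Lebesgue measure. Under nu_s the first
   digit is k with probability P_s(k) = (1 + s) / ((k + s) (k + 1 + s)), and
   given this the Gauss map has law nu_{1 / (k + s)}. Hence the probability that
   each of the first n digits lies in a prescribed set is at most the product of
   sup_s P_s of these sets. As P_s(k) is comparable to 1 / k^2, Chebyshev's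
   bounds give that sup_s and inf_s of P_s(primes > b) are comparable to
   min(1, 1 / (b ln b)). The product bound with one constrained digit gives the
   first Borel-Cantelli lemma; with all late digits constrained to avoid large
   primes it gives directly that the complement of the limsup event is null.
   For (b), if b is bounded both events have full measure by (a), and if b is
   unbounded the two events coincide. *)
Require Import Defs.
From mathcomp Require Import all_boot all_order all_algebra all_classical all_reals all_analysis.
From mathcomp Require Import measurable_realfun ring lra zify.
Import Order.TTheory GRing.Theory Num.Theory.
Set Implicit Arguments. Unset Strict Implicit. Unset Printing Implicit Defensive.

(** * Chebyshev bounds at powers of two *)

Definition prime_count (m n : nat) : nat := count prime (index_iota m.+1 n.+1).

Lemma prime_count_cat m n k : m <= n -> n <= k ->
  prime_count m k = prime_count m n + prime_count n k.
Proof.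
move=> mn nk; rewrite /prime_count -count_cat; congr (count _ _).
rewrite /index_iota -(subnKC mn); set d := n - m.
rewrite -[X in _ ++ iota X _]addSn.
rewrite (_ : k.+1 - m.+1 = d + (k.+1 - (m + d).+1)); last by rewrite /d; lia.
by rewrite iotaD (_ : (m + d).+1 - m.+1 = d) //; lia.
Qed.

(** Distinct primes are coprime, so the divisors can be multiplied one at a time. *)
Lemma prod_primes_dvd (s : seq nat) m :
  uniq s -> all prime s -> all (dvdn^~ m) s -> \prod_(p <- s) p %| m.
Proof.
elim: s => [|p s IH] /=; first by rewrite big_nil dvd1n.
move=> /andP[pNs us] /andP[pp ps] /andP[pm sm].
rewrite big_cons Gauss_dvd ?pm ?IH//.
rewrite coprime_sym; elim: s pNs ps {us sm IH} => [|q s IH] /=.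
  by rewrite big_nil coprime1n.
rewrite inE negb_or => /andP[pq pNs] /andP[qq qs].
by rewrite big_cons coprimeMl IH// andbT prime_coprime// dvdn_prime2// eq_sym.
Qed.

Lemma leq_expn_count (s : seq nat) n : all (leq n) s -> n ^ size s <= \prod_(p <- s) p.
Proof.
elim: s => [|p s IH] /=; first by rewrite big_nil.
by move=> /andP[np /IH h]; rewrite big_cons expnS leq_mul.
Qed.

Lemma central_bin_le n : 'C(n.*2, n) <= 2 ^ n.*2.
Proof.
rewrite -[2]/(1 + 1) expnDn.
have nn : n < n.*2.+1 by rewrite ltnS -addnn leq_addr.
rewrite (bigD1 (Ordinal nn))//= !exp1n !muln1; exact: leq_addr.
Qed.

(** Pascal's rule splits C(2n+2, n+1) into C(2n+1, n+1) and C(2n+1, n), each at least C(2n, n). *)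
Lemma central_bin_ge n : 2 ^ n <= 'C(n.*2, n).
Proof.
elim: n => // n IH; rewrite doubleS binS expnS mul2n -addnn.
apply: leq_add; apply: leq_trans IH _; last first.
  by case: n => // n; rewrite binS leq_addr.
by rewrite binS leq_addl.
Qed.

(** A prime in (n, 2n] divides (2n)! but not n!, hence divides C(2n, n); so does the product of all
    these primes, each of which exceeds n. *)
Lemma prime_count_central n : n ^ prime_count n n.*2 <= 'C(n.*2, n).
Proof.
have b0 : 0 < 'C(n.*2, n) by rewrite bin_gt0 -addnn leq_addr.
rewrite /prime_count -size_filter; apply: leq_trans (dvdn_leq b0 _).
  apply: leq_expn_count; apply/allP => p.
  by rewrite mem_filter mem_index_iota => /andP[_ /andP[/ltnW]].
apply: prod_primes_dvd; first by rewrite filter_uniq// iota_uniq.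
  exact: filter_all.
apply/allP => p; rewrite mem_filter mem_index_iota => /and3P[pp np pn].
have := bin_fact (_ : n <= n.*2); rewrite -addnn leq_addr addnK => /(_ isT) e.
have : p %| (n + n)`! by apply: dvdn_fact; rewrite prime_gt0//= addnn.
have pNn : (p %| n`!) = false.
  have : forall m, m <= n -> (p %| m`!) = false.
    elim=> [|m IH] mn; first by rewrite dvdn1; apply/eqP => p1; rewrite p1 in pp.
    by rewrite factS Euclid_dvdM// IH 1?ltnW// orbF gtnNdvd// (leq_ltn_trans mn).
  exact.
by rewrite -e !Euclid_dvdM// pNn !orbF.
Qed.

Lemma prime_count_dyadic_le j : j * prime_count (2 ^ j) (2 ^ j.+1) <= 2 ^ j.+1.
Proof.
have := leq_trans (prime_count_central (2 ^ j)) (central_bin_le (2 ^ j)).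
by rewrite -expnM leq_exp2l// -mul2n -expnS.
Qed.

(** By Legendre's formula the exponent of p is the sum over k of floor(2n / p^k) - 2 floor(n / p^k).
    Each term is at most 1, and only those with p^k <= 2n count. *)
Lemma central_bin_pfactor p n : prime p -> 0 < n -> p ^ logn p 'C(n.*2, n) <= n.*2.
Proof.
move=> pp n0; have p1 := prime_gt1 pp.
have n20 : 0 < n.*2 by rewrite double_gt0.
have [h1 h2] : p ^ trunc_log p n.*2 <= n.*2 /\ n.*2 < p ^ (trunc_log p n.*2).+1.
  by split; [exact: trunc_logP | exact: trunc_log_ltn].
apply: leq_trans h1; rewrite leq_exp2l//; set t := trunc_log _ _ in h2 *.
have b0 : 0 < 'C(n.*2, n) by rewrite bin_gt0 -addnn leq_addr.
have := bin_fact (_ : n <= n.*2); rewrite -addnn leq_addr addnK => /(_ isT).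
rewrite addnn => /(congr1 (logn p)); rewrite !lognM ?muln_gt0 ?fact_gt0// !logn_fact//.
have tn : t <= n.*2.
  by rewrite -ltnS; have := ltn_expl t p1; have := trunc_logP p1 n20; rewrite -/t; lia.
have -> : \sum_(1 <= k < n.*2.+1) n.*2 %/ p ^ k = \sum_(1 <= k < t.+1) n.*2 %/ p ^ k.
  rewrite (@big_cat_nat _ _ _ t.+1 1)//= [X in _ + X]big_nat_cond.
  rewrite [X in _ + X]big1 ?addn0// => k /andP[/andP[tk _] _].
  by rewrite divn_small//; apply: leq_trans h2 _; rewrite leq_exp2l.
set A := \sum_(1 <= k < n.+1) _ => h.
have hA : \sum_(1 <= k < t.+1) n %/ p ^ k <= A.
  rewrite /A; have [tn'|nt] := leqP t n.
    by rewrite (@big_cat_nat _ _ _ t.+1 1 n.+1)//= leq_addr.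
  rewrite (@big_cat_nat _ _ _ n.+1 1 t.+1)//=; last by lia.
  rewrite [X in _ + X]big_nat_cond [X in _ + X]big1 ?addn0// => k /andP[/andP[nk _] _].
  by rewrite divn_small// (leq_trans nk)// ltnW// ltn_expl.
have : \sum_(1 <= k < t.+1) n.*2 %/ p ^ k <=
    \sum_(1 <= k < t.+1) (n %/ p ^ k + n %/ p ^ k + 1).
  apply: leq_sum => k _; have : 0 < p ^ k by rewrite expn_gt0 ltnW.
  move: (p ^ k) => d d0; rewrite {1}(divn_eq n d) -addnn.
  have := ltn_mod n d; rewrite d0 => hr.
  rewrite [X in X %/ d](_ : _ = (n %/ d + n %/ d) * d + (n %% d + n %% d)); last by lia.
  rewrite divnMDl// leq_add2l -ltnS ltn_divLR//; lia.
rewrite !big_split/= sum_nat_const_nat; lia.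
Qed.

(** The coefficient is the product of its prime-power parts, each at most 2n, and its primes are at
    most 2n. *)
Lemma central_bin_le_prime_count n : 0 < n -> 'C(n.*2, n) <= n.*2 ^ prime_count 0 n.*2.
Proof.
move=> n0; set c := 'C(_, _).
have b0 : 0 < c by rewrite bin_gt0 -addnn leq_addr.
(* The factorization runs over p <= c; the cut at min(c, 2n) separates the primes above 2n, which do
   not divide (2n)!. *)
rewrite -{1}(@partnT c)// /partn (@big_cat_nat _ _ _ (minn c n.*2).+1)//=; last first.
  by rewrite ltnS geq_minl.
rewrite [X in _ * X]big_nat_cond [X in _ * X]big1 ?muln1; last first.
  move=> p /andP[/andP[h1 h2] _]; rewrite -p_part; apply/eqP.
  rewrite p_part_eq1 mem_primes; apply/negP => /and3P[pp _ pc].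
  have : p %| (n.*2)`!.
    by rewrite -(@bin_fact n.*2 n) ?dvdn_mulr// -addnn leq_addr.
  have : n.*2 < p by move: h1 h2; rewrite ltnS; lia.
  move=> np; have : forall m, m < p -> (p %| m`!) = false.
    elim=> [|m IH] mp; first by rewrite dvdn1; apply/eqP => p1; rewrite p1 in pp.
    by rewrite factS Euclid_dvdM// IH 1?ltnW// orbF gtnNdvd.
  by move=> ->.
rewrite big_ltn_cond//= big_mkcond/= lognE/= expn0 mul1n.
apply: (@leq_trans (\prod_(1 <= p < n.*2.+1 | prime p) p ^ logn p c)).
  rewrite [leqRHS](@big_cat_nat _ _ _ (minn c n.*2).+1)//=; last by rewrite ltnS geq_minr.
  rewrite -[leqLHS]muln1 leq_mul//.
    rewrite [leqRHS]big_mkcond/= leq_prod// => p _; case: ifP => // pN.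
    by rewrite lognE pN.
  by apply: prodn_cond_gt0 => p pp; rewrite expn_gt0 prime_gt0.
apply: (@leq_trans (\prod_(1 <= p < n.*2.+1 | prime p) n.*2)).
  by apply: leq_prod => p pp; exact: central_bin_pfactor.
by rewrite big_const_seq iter_muln_1 /prime_count.
Qed.

Lemma prime_count_dyadic_ge j : 2 ^ j <= j.+1 * prime_count 0 (2 ^ j.+1).
Proof.
have j0 : 0 < 2 ^ j by rewrite expn_gt0.
have := leq_trans (central_bin_ge (2 ^ j)) (central_bin_le_prime_count j0).
by rewrite -mul2n -expnS -expnM leq_exp2l.
Qed.

(** Octaves are added one at a time. Passing from i to i + 1 needs 8 (i + 1) <= 12 i, which holds
    from i = 2 on; smaller exponents use the trivial count. *)
Lemma prime_count_pow2_le j : j * prime_count 0 (2 ^ j) <= 6 * 2 ^ j.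
Proof.
have c0 k : prime_count 0 k <= k.
  by rewrite /prime_count (leq_trans (count_size _ _))// size_iota subn1.
elim: j => // -[|[|j]] IH.
- have := c0 (2 ^ 1); lia.
- have := c0 (2 ^ 2); rewrite (_ : 2 ^ 2 = 4)//; lia.
have := prime_count_dyadic_le j.+2.
rewrite (@prime_count_cat 0 (2 ^ j.+2) (2 ^ j.+3)) ?leq_exp2l//.
move: IH; set x := prime_count 0 _; set y := prime_count _ _; rewrite (expnS 2 j.+2).
set z := 2 ^ j.+2 => h1 h2.
rewrite -(leq_pmul2l (_ : 0 < j.+2))//.
have h3 : j.+3 * (j.+2 * x + j.+2 * y) <= j.+3 * (8 * z) by rewrite leq_mul2l; apply/orP; right; lia.
apply: (@leq_trans (j.+3 * (8 * z))); first by lia.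
have : (j.+3 * 8) * z <= (j.+2 * 12) * z by rewrite leq_mul2r; lia.
lia.
Qed.

(** The upper bound at 2^j is subtracted from the lower bound at 2^(j+7). Seven octaves make this
    work from j = 1 on, as 7 (j + 7) <= 64 j. *)
Lemma prime_count_seven_octaves_ge j : 0 < j -> 2 ^ j <= j * prime_count (2 ^ j) (2 ^ (j + 7)).
Proof.
move=> j0.
have h1 := prime_count_dyadic_ge (j + 6).
have h2 := prime_count_pow2_le j.
move: h1; rewrite -addnS (@prime_count_cat 0 (2 ^ j) (2 ^ (j + 7))) ?leq_exp2l ?leq_addr//.
rewrite (expnD _ j 6) (_ : 2 ^ 6 = 64)//; move: h2.
set x := prime_count 0 _; set y := prime_count _ _; set z := 2 ^ j => h2 h1.
rewrite -(@leq_pmul2l (j + 7)); last by lia.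
have h3 : j * (z * 64) <= j * ((j + 7) * (x + y)) by rewrite leq_mul2l h1 orbT.
have h4 : (j + 7) * (j * x) <= (j + 7) * (6 * z) by rewrite leq_mul2l h2 orbT.
have h5 : ((j + 7) * 7) * z <= (j * 64) * z by rewrite leq_mul2r; lia.
lia.
Qed.

Local Open Scope classical_set_scope.
Local Open Scope ring_scope.

(** * Digit distributions *)

Lemma measurable_inv (R : realType) : measurable_fun setT (fun x : R => x^-1).
Proof.
have -> : [set: R] = ([set 0] `|` ~` [set 0]) by rewrite setUv.
apply/measurable_funU; [exact: measurable_set1|by apply: measurableC; exact: measurable_set1|].
split; first exact: measurable_fun_set1.
apply: open_continuous_measurable_fun; first exact/closed_openC/closed_eq.
by move=> x /[!inE] /eqP x0; exact: inv_continuous.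
Qed.

Lemma measurable_truncn (R : realType) :
  measurable_fun setT (fun x : R => (Num.truncn x)%:R : R).
Proof.
apply: nondecreasing_measurable => // x y xy.
by rewrite ler_nat le_truncn.
Qed.

Lemma measurable_gauss (R : realType) : measurable_fun setT (@gauss R).
Proof.
apply: measurable_funB; first exact: measurable_inv.
apply: (measurableT_comp (@measurable_truncn R)); exact: measurable_inv.
Qed.

Lemma measurable_cf_digit (R : realType) n :
  measurable_fun setT (fun x : R => (cf_digit n x)%:R : R).
Proof.
rewrite /cf_digit; apply: (measurableT_comp (@measurable_truncn R)).
apply: (measurableT_comp (@measurable_inv R)).
elim: n.-1 => [|m IH]; first exact: measurable_id.
exact: (measurableT_comp (@measurable_gauss R) IH).
Qed.

(** The map [f] allows for digits of x itself as well as of [mobius s u]. *)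
Lemma measurable_cf_digit_pred (R : realType) (f : R -> R) n (C : pred nat) :
  measurable_fun setT f -> measurable [set x : R | C (cf_digit n (f x))].
Proof.
move=> mf; have -> : [set x : R | C (cf_digit n (f x))] =
    (\bigcup_(k in [set k | C k]) ((fun x => (cf_digit n (f x))%:R : R) @^-1` [set k%:R])).
  apply/seteqP; split=> x /=; first by move=> Cx; exists (cf_digit n (f x)).
  by case=> k /= Ck /eqP; rewrite eqr_nat => /eqP ->.
apply: bigcup_measurable => k _; rewrite -[X in measurable X]setTI.
apply: (measurableT_comp (@measurable_cf_digit R n) mf) => //; exact: measurable_set1.
Qed.

(** Scaled by 1 / p, the pushforward agrees with Lebesgue measure on half-open intervals, so
    uniqueness applies. The decreasing form is that of [branch]. *)
Lemma lebesgue_measure_affine (R : realType) (c p : R) (A : set R) :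
  0 < p -> measurable A ->
  lebesgue_measure ((fun x => (c - x) / p) @^-1` A) = (p%:E * lebesgue_measure A)%E.
Proof.
move=> p0 mA.
pose f : R -> measurableTypeR R := fun x => (c - x) / p.
have mf : measurable_fun setT f.
  by apply: measurable_funM => //; exact: measurable_funB.
have pi0 : 0 <= p^-1 by rewrite invr_ge0 ltW.
pose mu : {measure set (measurableTypeR R) -> \bar R} :=
  mscale (NngNum pi0) (pushforward (@lebesgue_measure R) f).
have -> : lebesgue_measure A = mu mf A.
  apply: lebesgue_measure_unique => // _ [[a b]] _ <-.
  rewrite /mu /= /mscale /= /pushforward.
  rewrite (_ : (f @^-1` _) = `[c - p * b, c - p * a[%classic); last first.
    apply/seteqP; split=> x /=; rewrite !in_itv/= ltr_pdivlMr// ler_pdivrMr//;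
      move=> /andP[h1 h2]; apply/andP; split; lra.
  rewrite !lebesgue_measure_itv/= !lte_fin ltrD2l ltrN2 ltr_pM2l//.
  case: ifP => _; last by rewrite mule0.
  rewrite -!EFinB -EFinM; congr (_ %:E); field; exact: lt0r_neq0.
by rewrite /mu /= /mscale /= /pushforward muleA -EFinM divff ?mul1e// gt_eqF.
Qed.

Section conditional_digits.
Context {R : realType}.
Implicit Types (s u : R) (C : nat -> pred nat).

(* [mobius s] is the inverse of the distribution function
   x |-> (1 + s) x / (1 + s x), so it carries the uniform law to the law of
   density (1 + s) / (1 + s x)^2. *)
Definition mobius s u : R := u / (1 + s - s * u).

Definition digit_prob s (k : nat) : R := (1 + s) / ((k%:R + s) * (k%:R + 1 + s)).

(** Stated in the uniform coordinate u, so that probability under nu_s is plain Lebesgue measure.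
    Here [C i] constrains the digit of index i + 1. *)
Definition digit_set s C n : set R :=
  [set u | 0 <= u < 1 /\ forall i, (i < n)%N -> C i (cf_digit i.+1 (mobius s u))].

(** The decreasing affine bijection onto [0, 1) from ((1+s)/(k+1+s), (1+s)/(k+s)], the range of u
    with first digit k, whose length is [digit_prob s k]. *)
Definition branch s k u : R := ((1 + s) / (k%:R + s) - u) / digit_prob s k.

Lemma digit_prob_gt0 s k : 0 <= s -> (0 < k)%N -> 0 < digit_prob s k.
Proof.
move=> s0 k0; have : 0 < k%:R :> R by rewrite ltr0n.
by move=> k1; rewrite divr_gt0// ?mulr_gt0//; lra.
Qed.

Lemma measurable_digit_set s C n : measurable (digit_set s C n).
Proof.
have -> : digit_set s C n = (`[0, 1[ `&` \bigcap_(i in [set i | (i < n)%N])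
    [set u | C i (cf_digit i.+1 (mobius s u))]).
  by apply/seteqP; split=> u /=; rewrite in_itv.
apply: measurableI; first exact: measurable_itv.
apply: bigcap_measurableType => i _; apply: measurable_cf_digit_pred.
apply: measurable_funM => //; apply: (measurableT_comp (@measurable_inv R)).
apply: measurable_funB => //; exact: measurable_funM.
Qed.

Lemma cf_digitS n x : cf_digit n.+2 x = cf_digit n.+1 (@gauss R x).
Proof. by rewrite /cf_digit /= -iterS iterSr. Qed.

(* Under the law with density (1 + s) / (1 + s x)^2 and conditionally on the
   first digit being k, the Gauss map has the law of parameter 1 / (k + s);
   in the uniform coordinate u this is the affine map [branch s k]. Only an
   inclusion holds: for k = 1 the point u = 1 is outside [0, 1). *)
Lemma digit_set_branch s C n u : 0 <= s -> u != 0 -> digit_set s C n.+1 u ->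
  exists k, [/\ (0 < k)%N, C 0%N k &
    digit_set (k%:R + s)^-1 (fun i => C i.+1) n (branch s k u)].
Proof.
move=> s0 u0 [/andP[u0' u1] Cu].
have {u0 u0'} u0 : 0 < u by rewrite lt_neqAle eq_sym u0.
have su : s * u <= s by rewrite ler_piMr// ltW.
have xV : (mobius s u)^-1 = (1 + s) / u - s.
  by rewrite /mobius; field; rewrite !gt_eqF//; lra.
set k := cf_digit 1 (mobius s u).
have x1 : 1 <= (1 + s) / u - s by rewrite lerBrDr ler_pdivlMr//; nra.
have kE : k = Num.truncn ((1 + s) / u - s) by rewrite /k /cf_digit /= xV.
have := truncn_itv (le_trans ler01 x1); rewrite -kE => /andP[k1 k2].
have k0 : (0 < k)%N by rewrite kE truncn_gt0.
have kR : 0 < k%:R :> R by rewrite ltr0n.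
have P0 := digit_prob_gt0 s0 k0.
exists k; split => //; first exact: (Cu 0%N).
(* The inequalities k <= 1/x < k + 1 become linear in u. *)
have h1 : (k%:R + s) * u <= 1 + s by move: k1; rewrite lerBrDr ler_pdivlMr.
have h2 : 1 + s < (k%:R + 1 + s) * u.
  by move: k2; rewrite ltrBlDr ltr_pdivrMr// -natr1.
have bE : branch s k u = (k%:R + 1 + s) * (1 + s - (k%:R + s) * u) / (1 + s).
  by rewrite /branch /digit_prob; field; rewrite !gt_eqF//; lra.
have gE : mobius (k%:R + s)^-1 (branch s k u) = gauss (mobius s u).
  rewrite /gauss -/(cf_digit 1 (mobius s u)) -/k xV bE /mobius.
  by field; rewrite !gt_eqF//; nra.
split.
  rewrite bE divr_ge0 ?mulr_ge0 ?ltr_pdivrMr ?mul1r//=; [nra|lra..].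
by move=> i ni; rewrite gE -cf_digitS; exact: Cu.
Qed.

(** Induction on n, splitting by the first digit k: [branch s k] scales measure by [digit_prob s k]
    and leaves n constraints at parameter 1 / (k + s). This lies in [0, 1] again, so [r] has to be
    uniform in the parameter. *)
Lemma lebesgue_measure_digit_set C (r : nat -> R) n s :
  (forall i s', 0 <= s' <= 1 -> forall N,
     \sum_(1 <= k < N | C i k) digit_prob s' k <= r i) ->
  0 <= s <= 1 ->
  (lebesgue_measure (digit_set s C n) <= (\prod_(i < n) r i)%:E)%E.
Proof.
elim: n s C r => [|n IH] s C r hr s01.
  rewrite big_ord0 (_ : digit_set s C 0 = `[0, 1[%classic); last first.
    by apply/seteqP; split=> u /=; rewrite in_itv//= => -[].
  by rewrite lebesgue_measure_itv/= lte01 sube0.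
have s0 : 0 <= s by case/andP: s01.
(* The empty partial sum already forces nonnegativity. *)
have r0 i : 0 <= r i by have := hr i s s01 0%N; rewrite big_geq.
pose A k := if (0 < k)%N && C 0%N k then
  (branch s k @^-1` digit_set (k%:R + s)^-1 (fun i => C i.+1) n) else set0.
(* Index 0, which is no first digit here, holds the exceptional point u = 0. *)
pose F k := if k is k'.+1 then A k else [set (0 : R)].
have mF k : measurable (F k).
  case: k => [|k]; first exact: measurable_set1.
  rewrite /F /A; case: ifP => // _; rewrite -[X in measurable X]setTI.
  have mb : measurable_fun setT (branch s k.+1).
    by apply: measurable_funM => //; exact: measurable_funB.
  by apply: mb => //; exact: measurable_digit_set.
have sub : (digit_set s C n.+1 `<=` \bigcup_k F k).
  move=> u Du; have [->|u0] := eqVneq u 0; first by exists 0%N.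
  have [[|k] [k0 Ck Dk]] := digit_set_branch s0 u0 Du => //.
  by exists k.+1 => //; rewrite /F /A k0 Ck.
have := measure_sigma_subadditive (@lebesgue_measure R) mF
  (measurable_digit_set s C n.+1) sub.
move=> /le_trans; apply.
set Pr := \prod_(i < n) r i.+1.
have Pr0 : 0 <= Pr by apply: prodr_ge0.
apply: lime_le; first by apply: is_cvg_nneseries => k _ _; exact: measure_ge0.
apply: nearW => N.
apply: (@le_trans _ _ (\sum_(1 <= k < N | C 0%N k) (digit_prob s k * Pr)%:E)%E).
  case: N => [|N]; first by rewrite !big_geq.
  rewrite big_ltn// [X in (X + _)%E](_ : _ = 0%E) ?add0e; last exact: lebesgue_measure_set1.
  rewrite [leRHS]big_mkcond/=.
  rewrite big_nat_cond [leRHS]big_nat_cond; apply: lee_sum => -[//|k] _.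
  rewrite [F _]/= /A /=; case: ifP => Ck; last by rewrite measure0.
  have P0 := digit_prob_gt0 s0 (ltn0Sn k).
  rewrite lebesgue_measure_affine//; last exact: measurable_digit_set.
  rewrite [leRHS]EFinM.
  apply: lee_wpmul2l; first by rewrite lee_fin ltW.
  apply: (IH _ _ (fun i => r i.+1)) => [i s'|].
    exact: hr.
  have k1 : 1 <= k.+1%:R :> R by rewrite ler1n.
  by rewrite invr_ge0 invf_le1//; lra.
rewrite sumEFin lee_fin -mulr_suml big_ord_recl ler_wpM2r//; exact: hr.
Qed.

(** The sum telescopes: the k-th term is (1+s)/(k+s) - (1+s)/(k+1+s). *)
Lemma sum_digit_prob s N : 0 <= s ->
  \sum_(1 <= k < N.+1) digit_prob s k = 1 - (1 + s) / (N%:R + 1 + s).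
Proof.
move=> s0; elim: N => [|N IH]; first by rewrite big_geq//; field; lra.
have N0 : 0 <= N%:R :> R by [].
rewrite big_nat_recr//= IH /digit_prob -natr1; field; lra.
Qed.

Lemma sum_digit_prob_le1 s (C : pred nat) N : 0 <= s -> \sum_(1 <= k < N | C k) digit_prob s k <= 1.
Proof.
move=> s0; case: N => [|N]; first by rewrite big_geq.
apply: (@le_trans _ _ (\sum_(1 <= k < N.+1) digit_prob s k)).
  rewrite big_mkcond big_nat_cond [leRHS]big_nat_cond; apply: ler_sum => k /andP[/andP[k0 _] _].
  by case: ifP => // _; rewrite ltW// digit_prob_gt0.
have N0 : 0 <= N%:R :> R by [].
rewrite sum_digit_prob// lerBlDr lerDl divr_ge0//; lra.
Qed.

Lemma digit_prob_le s k : 0 <= s <= 1 -> (0 < k)%N -> digit_prob s k <= 2 / k%:R ^+ 2.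
Proof.
move=> /andP[s0 s1] k0; have kR : 1 <= k%:R :> R by rewrite ler1n.
rewrite /digit_prob ler_pdivrMr; last by nra.
rewrite mulrAC ler_pdivlMr; last by nra.
nra.
Qed.

(** The denominator is at most (k + 1)(k + 2) <= 6 k^2. *)
Lemma digit_prob_ge s k : 0 <= s <= 1 -> (0 < k)%N -> (6 * k%:R ^+ 2)^-1 <= digit_prob s k.
Proof.
move=> /andP[s0 s1] k0; have kR : 1 <= k%:R :> R by rewrite ler1n.
rewrite /digit_prob -[leLHS]mul1r ler_pdivrMr; last by nra.
rewrite mulrAC ler_pdivlMr; last by nra.
nra.
Qed.

End conditional_digits.

(** * Tails over primes *)

Section prime_tails.
Context {R : realType}.
Implicit Types (b s : R).

Lemma sum_primes_const m n (c : R) :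
  \sum_(m.+1 <= k < n.+1 | prime k) c = c *+ prime_count m n.
Proof. by rewrite big_const_seq iter_addr_0. Qed.

(** The octave above 2^i, with i >= j, has at most 2^(i+1) / j primes, each contributing at most 2 /
    4^i. The resulting 4 / (j 2^i) is 8/j times 2^-i - 2^-(i+1), which telescopes. *)
Lemma sum_prime_sqV_le j M : (0 < j)%N ->
  \sum_((2 ^ j).+1 <= k < (2 ^ (j + M)).+1 | prime k) 2 / k%:R ^+ 2
    <= 8 / j%:R * (2 ^- j - 2 ^- (j + M)) :> R.
Proof.
move=> j0; elim: M => [|M IH]; first by rewrite addn0 subrr mulr0 big_geq.
have jR : 0 < j%:R :> R by rewrite ltr0n.
rewrite (@big_cat_nat _ _ _ (2 ^ (j + M)).+1)/=; [|by rewrite ltnS leq_exp2l//; lia..].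
apply: (le_trans (lerD IH (_ : _ <= 8 / j%:R * (2 ^- (j + M) - 2 ^- (j + M.+1))))); last first.
  by rewrite -mulrDr subrKA.
rewrite addnS; set i := (j + M)%N.
have p0 : 0 < 2 ^+ i :> R by rewrite exprn_gt0.
apply: (@le_trans _ _ (\sum_((2 ^ i).+1 <= k < (2 ^ i.+1).+1 | prime k) 2 / (2 ^+ i) ^+ 2)).
  rewrite big_nat_cond [leRHS]big_nat_cond; apply: ler_sum => k /andP[/andP[k1 _] _].
  have kR : 2 ^+ i <= k%:R :> R by rewrite -natrX ler_nat ltnW.
  rewrite ler_pM2l// lef_pV2 ?posrE ?exprn_gt0//; last exact: lt_le_trans kR.
  by rewrite lerXn2r// nnegrE; [exact: ltW|exact: le_trans (ltW p0) kR].
rewrite sum_primes_const -[leLHS]mulr_natr.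
have := prime_count_dyadic_le i; rewrite -(ler_nat R) natrM natrX exprS.
set c := (prime_count _ _)%:R => hc.
have ij : j%:R <= i%:R :> R by rewrite ler_nat leq_addr.
have {}hc : j%:R * c <= 2 * 2 ^+ i.
  by apply: le_trans hc; rewrite ler_wpM2r.
rewrite exprS [leLHS](_ : _ = 2 * c / (2 ^+ i) ^+ 2); last by rewrite mulrAC.
rewrite ler_pdivrMr ?exprn_gt0//.
rewrite [leRHS](_ : _ = 4 / j%:R * 2 ^+ i); last by field; rewrite !gt_eqF.
rewrite mulrAC ler_pdivlMr//; lra.
Qed.

Lemma dyadic_index b : 1 < b -> exists j, 2 ^+ j <= b < 2 ^+ j.+1.
Proof.
move=> b1; have b0 : 0 <= b by lra.
have n0 : (0 < Num.truncn b)%N by rewrite truncn_gt0 ltW.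
have := truncn_itv b0 => /andP[h1 h2].
exists (trunc_log 2 (Num.truncn b)); apply/andP; split.
  by apply: le_trans h1; rewrite -natrX ler_nat trunc_logP.
apply: (lt_le_trans h2); rewrite -natrX ler_nat; exact: trunc_log_ltn.
Qed.

Lemma ln2_le1 : ln 2 <= 1 :> R.
Proof. by apply: (@le_ln1Dx R 1); lra. Qed.

(** From exp(-1/2) >= 1 - 1/2, inverted. *)
Lemma ln2_ge_half : 2^-1 <= ln 2 :> R.
Proof.
rewrite -[leLHS]expRK ler_ln ?posrE ?expR_gt0//.
have := expR_ge1Dx (- 2^-1 : R); rewrite expRN => h.
have e0 := expR_gt0 (2^-1 : R).
rewrite -[leRHS]invrK -[leLHS]invrK lef_pV2 ?posrE ?invr_gt0//; lra.
Qed.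

Lemma mul_ln_gt0 b : 1 < b -> 0 < b * ln b.
Proof. by move=> b1; rewrite mulr_gt0// ?ln_gt0//; lra. Qed.

Lemma mul_ln_le b j : 1 < b -> b < 2 ^+ j.+1 -> b * ln b <= 2 ^+ j.+1 * j.+1%:R.
Proof.
move=> b1 bj; have b0 : 0 < b by lra.
apply: ler_pM; [exact: ltW|by rewrite ltW// ln_gt0|exact: ltW|].
apply: (@le_trans _ _ (ln (2 ^+ j.+1))); first by rewrite ler_ln ?posrE ?exprn_gt0// ltW.
by rewrite lnXn// -[leLHS]mulr_natl ler_piMr// ln2_le1.
Qed.

Lemma mul_ln_ge b j : 2 ^+ j <= b -> 2 ^+ j * (j%:R / 2) <= b * ln b.
Proof.
move=> bj; have p0 : 0 < 2 ^+ j :> R by rewrite exprn_gt0.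
rewrite ler_pM ?(ltW p0) ?divr_ge0//.
apply: (@le_trans _ _ (ln (2 ^+ j))); last first.
  by rewrite ler_ln ?posrE//; exact: lt_le_trans bj.
by rewrite lnXn// -[leRHS]mulr_natl ler_wpM2l// ln2_ge_half.
Qed.

(** If 2^J <= b < 2^(J+1) with J >= 1, the octaves above 2^J contribute at most 8 / (J 2^J), while b
    ln b <= (J+1) 2^(J+1) <= 4 J 2^J; hence 32. *)
Lemma sum_digit_prob_prime_le b s N : 1 < b -> 0 <= s <= 1 ->
  \sum_(1 <= k < N | prime k && (b < k%:R)) digit_prob s k <= 32 / (b * ln b).
Proof.
move=> b1 s01; have L0 := mul_ln_gt0 b1.
have [[|j] /andP[bj bj']] := dyadic_index b1.
  (* For b < 2 the total mass 1 is a sufficient bound, since b ln b <= 2. *)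
  apply: le_trans (sum_digit_prob_le1 _ _ _) _; first by case/andP: s01.
  have := mul_ln_le b1 bj'; rewrite expr1 mulr1 => h.
  by rewrite ler_pdivlMr// mul1r; lra.
have J0 : 0 < j.+1%:R :> R by rewrite ltr0n.
have p0 : 0 < 2 ^+ j.+1 :> R by rewrite exprn_gt0.
apply: (@le_trans _ _ (8 / j.+1%:R * 2 ^- j.+1)); last first.
  rewrite -mulrA -invfM ler_pdivlMr// mulrAC ler_pdivrMr ?mulr_gt0//.
  have := mul_ln_le b1 bj'; rewrite exprS -(natr1 j.+1) => h.
  have J1 : 1 <= j.+1%:R :> R by rewrite ler1n.
  nra.
(* N octaves are certainly enough to reach the cutoff N. *)
have N2 : (N <= 2 ^ (j.+1 + N))%N.
  by rewrite (leq_trans (ltnW (ltn_expl N (ltnSn 1))))// leq_exp2l// leq_addl.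
have := @sum_prime_sqV_le j.+1 N isT.
have hM : 8 / j.+1%:R * (2 ^- j.+1 - 2 ^- (j.+1 + N)) <= 8 / j.+1%:R * 2 ^- j.+1 :> R.
  rewrite ler_pM2l ?divr_gt0// gerBl invr_ge0 exprn_ge0//.
move=> /le_trans /(_ hM); apply: le_trans.
set B := (2 ^ j.+1).+1.
have term_ge0 k : 0 <= 2 / k%:R ^+ 2 :> R by rewrite divr_ge0 ?exprn_ge0.
apply: (@le_trans _ _ (\sum_(B <= k < N | prime k) 2 / k%:R ^+ 2)).
  have zero m n : (n <= B)%N ->
      \sum_(m <= k < n | prime k && (b < k%:R)) digit_prob s k = 0.
    move=> nB; rewrite big_nat_cond big1// => k /andP[/andP[_ kn] /andP[_]].
    move=> /(le_lt_trans bj); rewrite -natrX ltr_nat => /(leq_ltn_trans _).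
    by move=> /(_ _ (leqnn _)); rewrite ltnNge -ltnS (leq_trans kn).
  have [NB|BN] := leqP N B; first by rewrite zero// big_geq.
  rewrite (@big_cat_nat _ _ _ B)//=; last exact: ltnW.
  rewrite zero// add0r big_mkcond big_nat_cond [leRHS]big_mkcond [leRHS]big_nat_cond.
  apply: ler_sum => k /andP[/andP[Bk _] _].
  case: (prime k) => //=; case: ifP => // _; apply: digit_prob_le => //.
  exact: leq_ltn_trans Bk.
have [NB|BN] := leqP N B; first by rewrite big_geq// sumr_ge0.
rewrite [leRHS](@big_cat_nat _ _ _ N)//=; [|exact: ltnW|exact: leqW].
by rewrite lerDl sumr_ge0.
Qed.

(* The minimum with 1 accounts for b close to 1, where 1 / (b ln b) is unbounded. *)
Lemma sum_digit_prob_nonprime_le : exists2 c : R, 0 < c <= 1 &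
  forall b s N, 1 < b -> 0 <= s <= 1 ->
  \sum_(1 <= k < N | ~~ (prime k && (b < k%:R))) digit_prob s k
    <= 1 - c * Order.min 1 (b * ln b)^-1.
Proof.
(* At least 2^(j+1) / (j+1) primes in the seven octaves above 2^(j+1) have probability at least 1 /
   (6 * 4^(j+8)) each. The product is c * 4 / (2^j (j+1)), where the 4 pays for b ln b >= 2^j (j+1)
   / 4 when j >= 1. *)
pose c : R := (24 * 2 ^+ 15)^-1.
have c0 : 0 < c by rewrite invr_gt0 mulr_gt0 ?exprn_gt0.
exists c; first by rewrite c0 invf_le1 ?mulr_gt0 ?exprn_gt0//; lra.
move=> b s N0 b1 s01; have L0 := mul_ln_gt0 b1; have s0 : 0 <= s by case/andP: s01.
have [j /andP[bj bj']] := dyadic_index b1.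
(* The left-hand sum grows with the cutoff, so the cutoff may be raised to cover the seven
   octaves. *)
pose N := maxn N0 (2 ^ (j.+1 + 7)).+1.
have pos k : (0 < k)%N -> 0 <= digit_prob s k by move=> k0; rewrite ltW// digit_prob_gt0.
apply: (@le_trans _ _ (\sum_(1 <= k < N | ~~ (prime k && (b < k%:R))) digit_prob s k)).
  have [N1|N1] := leqP N0 1.
    rewrite big_geq// big_nat_cond sumr_ge0// => k /andP[/andP[k0 _] _]; exact: pos.
  rewrite [leRHS](@big_cat_nat _ _ _ N0)//=; [|exact: ltnW|exact: leq_maxl].
  rewrite lerDl big_nat_cond sumr_ge0// => k /andP[/andP[k0 _] _].
  by apply: pos; apply: leq_trans k0; exact: ltnW.
have := @sum_digit_prob_le1 _ s predT N s0.
rewrite (bigID (fun k => prime k && (b < k%:R)))/=.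
set A := \sum_(1 <= k < N | prime k && _) _.
suff : c * Order.min 1 (b * ln b)^-1 <= A by lra.
have p0 : 0 < 2 ^+ j :> R by rewrite exprn_gt0.
have J0 : 0 < j.+1%:R :> R by rewrite ltr0n.
have J1 : 1 <= j.+1%:R :> R by rewrite ler1n.
pose q : R := (6 * (2 ^+ (j.+1 + 7)) ^+ 2)^-1.
have q0 : 0 < q by rewrite invr_gt0 mulr_gt0 ?exprn_gt0.
have Aq : q *+ prime_count (2 ^ j.+1) (2 ^ (j.+1 + 7)) <= A.
  have B1 : ((2 ^ j.+1).+1 <= (2 ^ (j.+1 + 7)).+1)%N by rewrite ltnS leq_exp2l// leq_addr.
  have B2 : ((2 ^ (j.+1 + 7)).+1 <= N)%N by exact: leq_maxr.
  rewrite -sum_primes_const /A [leRHS](@big_cat_nat _ _ _ (2 ^ j.+1).+1)//=; last exact: leq_trans B2.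
  rewrite [X in _ <= _ + X](@big_cat_nat _ _ _ (2 ^ (j.+1 + 7)).+1)//=.
  have nn m n : (0 < m)%N ->
      0 <= \sum_(m <= k < n | prime k && (b < k%:R)) digit_prob s k.
    move=> m0; rewrite big_nat_cond sumr_ge0// => k /andP[/andP[mk _] _].
    by apply: pos; exact: leq_trans mk.
  rewrite addrA; apply: ler_wpDr; first exact: nn.
  apply: ler_wpDl; first exact: nn.
  rewrite big_mkcond big_nat_cond [leRHS]big_mkcond [leRHS]big_nat_cond.
  apply: ler_sum => k /andP[/andP[Bk kB] _]; case: (prime k) => //=.
  have -> : b < k%:R by apply: (lt_trans bj'); rewrite -natrX ltr_nat.
  have k0 : (0 < k)%N by exact: leq_trans Bk.
  apply: le_trans (digit_prob_ge s01 k0).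
  have kR : 0 < k%:R :> R by rewrite ltr0n.
  rewrite lef_pV2 ?posrE ?mulr_gt0 ?exprn_gt0// ler_pM2l//.
  have kB' : k%:R <= 2 ^+ (j.+1 + 7) :> R by rewrite -natrX ler_nat -ltnS.
  by rewrite lerXn2r// nnegrE; [exact: ltW|exact: exprn_ge0].
apply: le_trans Aq.
have := @prime_count_seven_octaves_ge j.+1 isT; rewrite -(ler_nat R) natrM natrX -(mulr_natr q).
set P := (prime_count _ _)%:R => hP.
have {}hP : 2 ^+ j.+1 / j.+1%:R <= P by rewrite ler_pdivrMr// mulrC.
apply: (@le_trans _ _ (q * (2 ^+ j.+1 / j.+1%:R))); last by rewrite ler_pM2l.
have -> : q * (2 ^+ j.+1 / j.+1%:R) = c * (4 / (2 ^+ j * j.+1%:R)).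
  rewrite /q /c !exprD !exprS expr0.
  by field; rewrite !gt_eqF.
(* For j = 0 the value 1 of the minimum is used, otherwise 1 / (b ln b). *)
rewrite ler_pM2l// ge_min; case: j bj {bj' N A q q0 hP P} p0 J0 J1 => [|j] bj p0 J0 J1.
  by rewrite expr0 mul1r divr1 ler1n.
apply/orP; right; rewrite -[leLHS]mul1r ler_pdivrMr//.
rewrite mulrAC ler_pdivlMr ?mulr_gt0//.
have := mul_ln_ge bj; rewrite -(natr1 j.+1).
have J2 : 1 <= j.+1%:R :> R by rewrite ler1n.
nra.
Qed.

End prime_tails.

(** * Borel-Cantelli *)

(** Either v < 1 eventually, and truncation does not change the tail, or infinitely many truncated
    terms equal 1. *)
Lemma sum_min1_unbounded (R : realType) (v : nat -> R) :
  (forall n, 0 <= v n) ->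
  (forall M : R, exists m, M < \sum_(0 <= i < m) v i) ->
  forall (M : R) N, exists m, M < \sum_(N <= i < m) Order.min 1 (v i).
Proof.
move=> v0 hv M N.
have w0 i : 0 <= Order.min 1 (v i) by rewrite le_min ler01 v0.
have [[K hK]|] := pselect (exists K, forall n, (K <= n)%N -> v n < 1).
  pose L := maxn K N.
  have [m hm] := hv (M + \sum_(0 <= i < L) v i).
  exists m; have [mL|Lm] := leqP m L.
    have : \sum_(0 <= i < m) v i <= \sum_(0 <= i < L) v i.
      by rewrite [leRHS](@big_cat_nat _ _ _ m)//= lerDl sumr_ge0.
    have : 0 <= \sum_(N <= i < m) Order.min 1 (v i) by rewrite sumr_ge0.
    lra.
  move: hm; rewrite (@big_cat_nat _ _ _ L 0 m)//=; last exact: ltnW.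
  rewrite (@big_cat_nat _ _ _ L N m)//=; [|exact: leq_maxr|exact: ltnW].
  have : 0 <= \sum_(N <= i < L) Order.min 1 (v i) by rewrite sumr_ge0.
  have -> : \sum_(L <= i < m) v i = \sum_(L <= i < m) Order.min 1 (v i).
    rewrite big_nat_cond [RHS]big_nat_cond; apply: eq_bigr => i /andP[/andP[Li _] _].
    by apply/esym/min_r/ltW/hK/(leq_trans _ Li)/leq_maxl.
  lra.
move=> hK.
have {}hK K : exists n, (K <= n)%N /\ 1 <= v n.
  apply: contrapT => h; apply: hK; exists K => n Kn; rewrite ltNge; apply/negP => vn.
  by apply: h; exists n.
suff [m hm] : exists m, (Num.truncn M).+1%:R <= \sum_(N <= i < m) Order.min 1 (v i).
  by exists m; exact: lt_le_trans (truncnS_gt _) hm.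
elim: (Num.truncn M).+1 => [|k [m hm]]; first by exists N; rewrite big_geq.
have [n [mn vn]] := hK (maxn N m); exists n.+1.
rewrite big_nat_recr/=; last by lia.
rewrite -natr1 lerD ?(min_l vn)//; apply: (le_trans hm).
have [mN|Nm] := leqP m N; first by rewrite [leLHS]big_geq// sumr_ge0.
rewrite [leRHS](@big_cat_nat _ _ _ m)//=; [|exact: ltnW|lia].
by rewrite lerDl sumr_ge0.
Qed.

Lemma prod_1B_le (R : realType) (c : R) (w : nat -> R) m n :
  (forall i, 0 <= 1 - c * w i) ->
  \prod_(m <= i < n) (1 - c * w i) <= expR (- (c * \sum_(m <= i < n) w i)).
Proof.
move=> h; rewrite mulr_sumr -sumrN expR_sum; apply: ler_prod => i _.
by rewrite h/=; apply: expR_ge1Dx.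
Qed.

Section prime_digits.
Context (R : realType) (b : nat -> R) (b_gt1 : forall n : nat, (0 < n)%N -> 1 < b n).
Local Notation mu := (@lebesgue_measure R).

(** Indexed from 0 to fit the constraints [C i] of [digit_set]. *)
Definition large_prime (i k : nat) : bool := prime k && (b i.+1 < k%:R).

(** As b > 1, the value 0 given to non-prime digits never exceeds b. *)
Lemma prime_digitE n (x : R) :
  (b n.+1 < (prime_digit n.+1 x)%:R) = large_prime n (cf_digit n.+1 x).
Proof.
rewrite /prime_digit /large_prime; case: ifP => //= _.
by apply/negbTE; rewrite -leNgt ltW// (lt_trans ltr01)// b_gt1.
Qed.

Lemma mobius0 (x : R) : mobius 0 x = x.
Proof. by rewrite /mobius addr0 mul0r subr0 divr1. Qed.

Lemma measurable_io_set (P : nat -> R -> Prop) :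
  (forall n, (0 < n)%N -> measurable [set x | P n x]) -> measurable (io_set P).
Proof.
move=> mP; have -> : io_set P = `]0, 1] `&`
    \bigcap_N \bigcup_(n in [set n | (N <= n)%N /\ (0 < n)%N]) [set x | P n x].
  apply/seteqP; split=> x /=; rewrite in_itv/= => -[x01 h]; split => //.
    by move=> N _; have [n [? [? ?]]] := h N; exists n.
  by move=> N; have [n [? ?] ?] := h N I; exists n.
apply: measurableI => //; apply: bigcapT_measurable => N.
by apply: bigcup_measurable => n [_]; exact: mP.
Qed.

Definition io_prime_digit : set R := io_set (fun n x => (prime_digit n x)%:R > b n).

Lemma measurable_io_prime_digit : measurable io_prime_digit.
Proof.
apply: measurable_io_set => -[//|n] _.
have -> : [set x | (prime_digit n.+1 x)%:R > b n.+1] =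
    [set x : R | large_prime n (cf_digit n.+1 x)].
  by apply/seteqP; split=> x /=; rewrite prime_digitE.
exact: (@measurable_cf_digit_pred R id).
Qed.

Let v (i : nat) : R := (b i.+1 * ln (b i.+1))^-1.

Let v_ge0 i : 0 <= v i.
Proof. by rewrite invr_ge0 ltW// mul_ln_gt0// b_gt1. Qed.

Lemma negligible_io_prime_digit :
  (\sum_(1 <= n <oo) ((b n * ln (b n))^-1)%:E <> +oo)%E -> mu io_prime_digit = 0%E.
Proof.
move=> fin; apply: measure_negligible; first exact: measurable_io_prime_digit.
(* Only the digit of index n + 1 is constrained. *)
pose C n i k := (i != n) || large_prime i k.
pose F n := digit_set (0 : R) (C n) n.+1.
(* The point 1 belongs to (0, 1] but not to the interval [0, 1) of [digit_set]. *)
apply: (@negligibleS _ _ _ mu ([set 1] `|` lim_sup_set F)).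
  move=> x [/andP[x0 x1] h]; have [->|xN1] := eqVneq x 1; [by left|right].
  move=> N _; have [[|n] [Nn [n0 hx]]] := h N.+1 => //.
  exists n => //; split; first by rewrite ltW// lt_neqAle xN1.
  move=> i; rewrite ltnS leq_eqVlt /C mobius0 => /predU1P[->|/ltn_eqF -> //].
  by rewrite eqxx -prime_digitE.
have mF n : measurable (F n) by exact: measurable_digit_set.
apply: negligibleU; first by exists [set 1]; split => //; exact: lebesgue_measure_set1.
exists (lim_sup_set F); split => //.
  apply: bigcapT_measurable => n; apply: bigcup_measurable => k _; exact: mF.
apply: lim_sup_set_cvg0 => //.
have muF n : (mu (F n) <= (32 * v n)%:E)%E.
  have -> : 32 * v n = \prod_(i < n.+1) (if i == n :> nat then 32 * v i else 1).
    rewrite big_ord_recr/= eqxx big1 ?mul1r// => i _.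
    by rewrite ltn_eqF.
  apply: (@lebesgue_measure_digit_set R (C n)
    (fun i => if i == n then 32 * v i else 1)); last by rewrite lexx ler01.
  move=> i s s01 N; rewrite /C; case: ifP => _; last first.
    by apply: sum_digit_prob_le1; case/andP: s01.
  by apply: sum_digit_prob_prime_le => //; exact: b_gt1.
set S := (X in X <> _) in fin.
have term_ge0 n : (1 <= n)%N -> (0 <= ((b n * ln (b n))^-1)%:E)%E.
  by move=> n0; rewrite lee_fin invr_ge0 ltW// mul_ln_gt0// b_gt1.
have S0 : (0 <= S)%E by apply: nneseries_ge0 => n n1 _; exact: term_ge0.
have Sfin : S \is a fin_num by rewrite ge0_fin_numE// ltey; apply/eqP.
apply: (@le_lt_trans _ _ (32%:E * S)%E); last first.
  by rewrite -(fineK Sfin) -EFinM ltry.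
apply: lime_le; first by apply: is_cvg_nneseries => n _ _; exact: measure_ge0.
apply: nearW => N.
apply: (@le_trans _ _ (\sum_(0 <= n < N) (32 * v n)%:E)%E); first by apply: lee_sum => n _; exact: muF.
under eq_bigr do rewrite EFinM.
rewrite -ge0_sume_distrr; last by move=> n _; rewrite lee_fin.
apply: lee_wpmul2l; first by rewrite lee_fin.
apply: le_trans (nneseries_lim_ge N.+1 _); last by move=> n n1 _; exact: term_ge0.
by rewrite big_add1.
Qed.

Lemma full_io_prime_digit :
  (\sum_(1 <= n <oo) ((b n * ln (b n))^-1)%:E = +oo)%E -> mu io_prime_digit = 1%E.
Proof.
move=> inf.
have hv M : exists m, M < \sum_(0 <= i < m) v i.
  apply: contrapT => h; have : (+oo <= M%:E :> \bar R)%E; last by [].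
  rewrite -inf; apply: lime_le.
    apply: is_cvg_nneseries => n n1 _.
    by rewrite lee_fin invr_ge0 ltW// mul_ln_gt0// b_gt1.
  apply: nearW => -[|m].
    by rewrite big_geq// lee_fin leNgt; apply/negP => M0; apply: h; exists 0%N; rewrite big_geq.
  by rewrite sumEFin lee_fin big_add1 leNgt; apply/negP => Mm; apply: h; exists m.
have [c /andP[c0 c1] hc] := @sum_digit_prob_nonprime_le R.
pose w i := Order.min 1 (v i).
have w1 i : 0 <= w i <= 1 by rewrite le_min ler01 v_ge0 ge_min lexx.
have cw i : 0 <= 1 - c * w i.
  have /andP[_ wi] := w1 i.
  by rewrite subr_ge0 (le_trans _ c1)// ler_piMr// (ltW c0).
pose C N i k := (i < N)%N || ~~ large_prime i k.
pose D N := \bigcap_m digit_set (0 : R) (C N) m.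
have mD N : measurable (D N).
  by apply: bigcapT_measurable => m; exact: measurable_digit_set.
have D0 N : mu (D N) = 0%E.
  apply/eqP; rewrite eq_le measure_ge0 andbT; apply/lee_addgt0Pr => e e0; rewrite add0e.
  (* With c times the sum above 1/e, the product is at most exp(-1/e) <= e, because exp(1/e) >=
     1/e. *)
  have [m hm] := sum_min1_unbounded v_ge0 hv (e^-1 / c) N.
  pose r i := if (i < N)%N then 1 else 1 - c * w i.
  apply: (@le_trans _ _ (mu (digit_set (0 : R) (C N) m))).
    by apply: le_measure; rewrite ?inE; [exact: mD|exact: measurable_digit_set|exact: bigcap_inf].
  apply: (@le_trans _ _ (\prod_(i < m) r i)%:E).
    apply: (@lebesgue_measure_digit_set R (C N) r); last by rewrite lexx ler01.
    move=> i s s01 n; rewrite /r /C; case: ifP => _.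
      by apply: sum_digit_prob_le1; case/andP: s01.
    by apply: hc => //; exact: b_gt1.
  rewrite lee_fin -(big_mkord xpredT r).
  have [mN|Nm] := leqP m N.
    have : e^-1 / c < 0 by rewrite (lt_le_trans hm)// big_geq.
    by rewrite ltNge divr_ge0 ?invr_ge0 ?(ltW e0) ?(ltW c0).
  rewrite (@big_cat_nat _ _ _ N)//=; last exact: ltnW.
  rewrite [X in X * _]big_nat_cond big1 ?mul1r; last first.
    by move=> i /andP[/andP[_ iN] _]; rewrite /r iN.
  rewrite big_nat_cond (eq_bigr (fun i => 1 - c * w i)); last first.
    by move=> i /andP[/andP[Ni _] _]; rewrite /r ltnNge Ni.
  rewrite -big_nat_cond; apply: le_trans (prod_1B_le _ _ cw) _.
  rewrite expRN invf_ple ?posrE ?expR_gt0//.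
  apply: le_trans (expR_ge1Dx _).
  move: hm; rewrite ltr_pdivrMr// mulrC => /ltW /le_trans; apply.
  by rewrite lerDr.
have mio := measurable_io_prime_digit.
apply/eqP; rewrite eq_le; apply/andP; split.
  have -> : 1%E = mu `]0, 1] by rewrite lebesgue_measure_itv/= lte01 sube0.
  apply: le_measure; rewrite ?inE//=.
  by move=> x [x01 _]; rewrite /= in_itv.
have sub : `]0, 1] `<=` io_prime_digit `|` ([set 1] `|` \bigcup_N D N).
  move=> x /=; rewrite in_itv/= => /andP[x0 x1].
  have [->|xN1] := eqVneq x 1; first by right; left.
  have [h|h] := pselect (io_prime_digit x); [by left|right; right].
  apply: contrapT => hD; apply: h; split; first by rewrite /unitI /= x0.
  move=> N; apply: contrapT => hN; apply: hD; exists N => // m _; split.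
    by rewrite ltW//= lt_neqAle xN1.
  move=> i _; rewrite /C mobius0; case: ltnP => //= Ni.
  rewrite -prime_digitE; apply/negP => hi; apply: hN; exists i.+1.
  by split; [exact: leqW|split].
have mZ : measurable ([set 1] `|` \bigcup_N D N).
  by apply: measurableU; [exact: measurable_set1|exact: bigcupT_measurable].
have Z : mu ([set 1] `|` \bigcup_N D N) = 0%E.
  apply: measure_negligible => //.
  apply: negligibleU; first by exists [set 1]; split => //; exact: lebesgue_measure_set1.
  by apply: negligible_bigcup => N; exists (D N); split; [exact: mD|exact: D0|].
have -> : 1%E = mu `]0, 1] by rewrite lebesgue_measure_itv/= lte01 sube0.
apply: (@le_trans _ _ (mu (io_prime_digit `|` ([set 1] `|` \bigcup_N D N)))).
  by apply: le_measure; rewrite ?inE//; exact: measurableU.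
rewrite -[leRHS]adde0 -Z; exact: measureU2.
Qed.

(** * The running maximum of the prime digits *)

Lemma io_prime_digit_max_subset :
  io_prime_digit `<=` io_set (fun n x => (prime_digit_max n x)%:R > b n).
Proof.
move=> x [x01 h]; split => // N; have [[|n] [Nn [n0 hn]]] := h N => //.
exists n.+1; split=> //; split=> //; apply: (lt_le_trans hn).
by rewrite ler_nat /prime_digit_max big_nat_recr//= leq_maxr.
Qed.

(** Positivity rules out the empty maximum, whose default value is 0. *)
Lemma prime_digit_max_attained n (x : R) : (0 < prime_digit_max n x)%N ->
  exists k, [/\ (0 < k)%N, (k <= n)%N & prime_digit_max n x = prime_digit k x].
Proof.
rewrite /prime_digit_max; elim: n => [|n IH]; first by rewrite big_geq.
rewrite big_nat_recr//= /maxn; case: ifP => _ M0; first by exists n.+1.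
by have [k [k0 kn ->]] := IH M0; exists k; split => //; exact: leqW.
Qed.

(** If the maximum up to n exceeds b n, it is attained at some k <= n, and b k <= b n gives an
    exceedance at k itself. Unboundedness of b makes k arbitrarily large. *)
Lemma io_prime_digit_max_eq :
  (forall n m : nat, (0 < n)%N -> (n <= m)%N -> b n <= b m) ->
  (forall M, exists n, (0 < n)%N /\ M < b n) ->
  io_set (fun n x => (prime_digit_max n x)%:R > b n) = io_prime_digit.
Proof.
move=> b_nd b_unbounded; apply/seteqP; split; last exact: io_prime_digit_max_subset.
move=> x [x01 h]; split => // N.
(* Beyond K the threshold exceeds every prime digit up to N, so the maximizing index cannot be below
   N. *)
have [K [K0 MK]] := b_unbounded (prime_digit_max N x)%:R.
have [n [Kn [n0 hn]]] := h K.
have M0 : (0 < prime_digit_max n x)%N.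
  by rewrite -(ltr_nat R) (lt_trans _ hn)// (lt_trans ltr01)// b_gt1.
have [k [k0 kn Mk]] := prime_digit_max_attained M0.
exists k; split; last by rewrite -Mk; split => //; exact: le_lt_trans (b_nd _ _ k0 kn) hn.
rewrite leqNgt; apply/negP => kN; have := lt_le_trans MK (b_nd _ _ K0 Kn).
move=> /lt_trans /(_ hn); rewrite ltr_nat Mk ltnNge => /negP; apply.
by rewrite /prime_digit_max (bigD1_seq k)/= ?leq_maxl ?iota_uniq// mem_index_iota k0 ltnW.
Qed.

Lemma measurable_io_prime_digit_max :
  measurable (@io_set R (fun n x => (prime_digit_max n x)%:R > b n)).
Proof.
apply: measurable_io_set => n n0.
have -> : [set x | (prime_digit_max n x)%:R > b n] = \bigcup_(k in [set k | (0 < k <= n)%N])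
    [set x : R | prime (cf_digit k x) && (b n < (cf_digit k x)%:R)].
  apply/seteqP; split=> x /=.
    move=> hn; have M0 : (0 < prime_digit_max n x)%N.
      by rewrite -(ltr_nat R) (lt_trans _ hn)// (lt_trans ltr01)// b_gt1.
    have [k [k0 kn Mk]] := prime_digit_max_attained M0.
    exists k; first by rewrite /= k0.
    move: hn M0; rewrite /= Mk /prime_digit; case: ifP => //.
  move=> [k /= /andP[k0 kn] /andP[pk hk]]; apply: (lt_le_trans hk); rewrite ler_nat.
  have -> : cf_digit k x = prime_digit k x by rewrite /prime_digit pk.
  by rewrite /prime_digit_max (bigD1_seq k)/= ?leq_maxl ?iota_uniq// mem_index_iota k0.
apply: bigcup_measurable => k _.
exact: (@measurable_cf_digit_pred R id k (fun d => prime d && (b n < d%:R))).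
Qed.

(** All terms are at least the positive constant 1 / (M ln M). *)
Lemma bounded_series_pinfty M : (forall n, (0 < n)%N -> b n <= M) ->
  (\sum_(1 <= n <oo) ((b n * ln (b n))^-1)%:E = +oo)%E.
Proof.
move=> bM; have M1 : 1 < M by exact: lt_le_trans (b_gt1 (ltn0Sn 0)) (bM _ _).
have L0 := mul_ln_gt0 M1.
have ge n : (1 <= n)%N -> (M * ln M)^-1 <= (b n * ln (b n))^-1.
  move=> n0; have b1 := b_gt1 n0.
  rewrite lef_pV2 ?posrE ?mul_ln_gt0//; apply: ler_pM; rewrite ?bM//.
  - by rewrite ltW// (lt_trans ltr01).
  - by rewrite ltW// ln_gt0.
  - by rewrite ler_ln ?posrE ?bM// (lt_trans ltr01).
apply/eqP; rewrite eq_le leey/= leye_eq; apply/eqP/eqyP => A A0.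
pose m := (Num.truncn (A * (M * ln M))).+1.
apply: (@le_trans _ _ (\sum_(1 <= n < m.+1) ((b n * ln (b n))^-1)%:E)%E); last first.
  apply: nneseries_lim_ge => n n1 _.
  by rewrite lee_fin invr_ge0 ltW// mul_ln_gt0// b_gt1.
rewrite sumEFin lee_fin.
apply: (@le_trans _ _ (\sum_(1 <= n < m.+1) (M * ln M)^-1)).
  rewrite sumr_const_nat subn1/= -[leRHS]mulr_natl ler_pdivlMr//.
  by rewrite ltW// truncnS_gt.
rewrite big_nat_cond [leRHS]big_nat_cond; apply: ler_sum => n /andP[/andP[n0 _] _].
exact: ge.
Qed.

End prime_digits.

Theorem theorem2p1 (R : realType) (b : nat -> R)
  (hb : forall n : nat, (0 < n)%N -> 1 < b n) :
  (* (a) *)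
  (((\sum_(1 <= n <oo) ((b n * ln (b n))^-1)%:E = +oo)%E ->
      @lebesgue_measure R (@io_set R (fun n x => (prime_digit n x)%:R > b n)) = 1%E) /\
   ((\sum_(1 <= n <oo) ((b n * ln (b n))^-1)%:E <> +oo)%E ->
      @lebesgue_measure R (@io_set R (fun n x => (prime_digit n x)%:R > b n)) = 0%E)) /\
  (* (b) *)
  ((forall n m : nat, (0 < n)%N -> (n <= m)%N -> b n <= b m) ->
     @lebesgue_measure R (@io_set R (fun n x => (prime_digit n x)%:R > b n)) =
     @lebesgue_measure R (@io_set R (fun n x => (prime_digit_max n x)%:R > b n))).
Proof.
split; first by split; [exact: full_io_prime_digit|exact: negligible_io_prime_digit].
move=> b_nd; have [h|h] := pselect (forall M, exists n, (0 < n)%N /\ M < b n).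
  by rewrite (io_prime_digit_max_eq hb b_nd h).
have [M bM] : exists M, forall n, (0 < n)%N -> b n <= M.
  apply: contrapT => hM; apply: h => M; apply: contrapT => h; apply: hM; exists M => n n0.
  by rewrite leNgt; apply/negP => Mb; apply: h; exists n.
have full := full_io_prime_digit hb (bounded_series_pinfty hb bM).
(* The event for the maximum lies between a set of measure 1 and (0, 1]. *)
rewrite [LHS]full; apply/esym/eqP; rewrite eq_le; apply/andP; split.
  have -> : 1%E = @lebesgue_measure R `]0, 1] by rewrite lebesgue_measure_itv/= lte01 sube0.
  apply: le_measure; rewrite ?inE//=; first exact: measurable_io_prime_digit_max.
  by move=> x [x01 _]; rewrite /= in_itv.
rewrite -full; apply: le_measure; rewrite ?inE.
- exact: measurable_io_prime_digit.
- exact: measurable_io_prime_digit_max.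
- exact: io_prime_digit_max_subset.
Qed.
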